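(* $v_t(n,i)=v_t(n,n-1-i)$ for all $0\le i\le n-1$.
   Context: $\mathfrak{S}_n$ is the set of permutations of $\{1,\ldots,n\}$, written as words; $\mathrm{id}=12\cdots n$; $\mathrm{des}(\pi)$ is the number of descents of $\pi$, i.e. of indices $j$ with $\pi_j>\pi_{j+1}$. The operator $\mathcal{T}$ (revstack sort) is defined recursively on finite words of distinct positive integers by $\mathcal{T}(\epsilon)=\epsilon$ for the empty word $\epsilon$, $\mathcal{T}(x)=x$ for a word $x$ of length 1, and $\mathcal{T}(LmR)=\mathcal{T}(R)\,\mathcal{T}(L)\,m$, where $m$ is the largest entry of the word $LmR$; $\mathcal{T}^t$ is its $t$-fold iterate, with $\mathcal{T}^0$ the identity map. A permutation $\pi\in\mathfrak{S}_n$ is $t$-revstack sortable if $\mathcal{T}^t(\pi)=\mathrm{id}$. For integers $n\ge 1$ and $t\ge 0$, $v_t(n,i)$ is the number of $t$-revstack sortable permutations in $\mathfrak{S}_n$ having exactly $i$ descents.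
   Formalization: The claim is stated for t ≥ 1 instead of t ≥ 0: at t = 0 only the identity is sortable, so v_0(2,0) = 1 but v_0(2,1) = 0, and the symmetry fails for every n ≥ 2. *)

(* Defs.v *)
From mathcomp Require Import all_boot perm.
Set Implicit Arguments.
Unset Strict Implicit.
Unset Printing Implicit Defensive.

(* Revstack sort by recursion on fuel [k]; [k = size w] is always enough.  The
   word is cut at its largest entry.  The intended recursive equations are
   [revstack_nil], [revstack_singleton] and [revstack_cat] below. *)
Fixpoint revstack_rec (k : nat) (w : seq nat) : seq nat :=
  match k, w with
  | k'.+1, _ :: _ =>
      let m := \max_(x <- w) x in
      let L := take (index m w) w in
      let R := drop (index m w).+1 w in
      revstack_rec k' R ++ revstack_rec k' L ++ [:: m]
  | _, _ => [::]
  end.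

Definition revstack (w : seq nat) : seq nat := revstack_rec (size w) w.

Lemma bigmax_mem (x : nat) (s : seq nat) : \max_(y <- x :: s) y \in x :: s.
Proof.
elim: s x => [|y s IHs] x; first by rewrite big_seq1 mem_head.
rewrite big_cons; have := IHs y; set M := \max_(z <- y :: s) z => hM.
by rewrite in_cons; case: (leqP x M) => h; rewrite ?hM ?orbT ?eqxx.
Qed.

Lemma revstack_recS (k : nat) (w : seq nat) : 0 < size w ->
  revstack_rec k.+1 w =
    let m := \max_(x <- w) x in
    revstack_rec k (drop (index m w).+1 w) ++
    revstack_rec k (take (index m w) w) ++ [:: m].
Proof. by case: w. Qed.

Lemma revstack_rec_fuel (k k' : nat) (w : seq nat) :
  size w <= k -> size w <= k' -> revstack_rec k w = revstack_rec k' w.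
Proof.
elim: k k' w => [|k IHk] [|k'] [|x s] // hk hk'.
rewrite !revstack_recS //=.
have := bigmax_mem x s; set m := \max_(y <- x :: s) y.
rewrite -index_mem -[if x == m then _ else _]/(index m (x :: s)).
move: (index m (x :: s)) => j hj.
have hR: size (drop j s) <= size s by rewrite size_drop leq_subr.
have hL: size (take j (x :: s)) <= size s by rewrite size_take hj.
rewrite (IHk k' (drop j s)) ?(leq_trans hR) //.
by rewrite (IHk k' (take j (x :: s))) ?(leq_trans hL).
Qed.

Lemma revstack_nil : revstack [::] = [::].
Proof. by []. Qed.

Lemma revstack_singleton (x : nat) : revstack [:: x] = [:: x].
Proof. by rewrite /revstack /= big_seq1. Qed.

Lemma revstack_cat (L R : seq nat) (m : nat) :
  all (fun x => x < m) (L ++ R) ->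
  revstack (L ++ m :: R) = revstack R ++ revstack L ++ [:: m].
Proof.
rewrite all_cat => /andP[/allP hL /allP hR].
have hm: \max_(x <- L ++ m :: R) x = m.
  apply/eqP; rewrite eqn_leq; apply/andP; split.
    apply/bigmax_leqP_seq => x; rewrite mem_cat in_cons => hx _.
    by case/or3P: hx => [/hL/ltnW //|/eqP -> //|/hR/ltnW].
  by apply: (@leq_bigmax_seq _ _ xpredT id) => //;
     rewrite mem_cat in_cons eqxx orbT.
have hi: index m (L ++ m :: R) = size L.
  rewrite index_cat ifF /= ?eqxx ?addn0 //.
  by apply/negP => /hL; rewrite ltnn.
rewrite {1}/revstack size_cat /= addnS revstack_recS ?size_cat ?addnS //= hm hi.
rewrite take_size_cat // -cat_rcons drop_size_cat ?size_rcons //.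
by congr (_ ++ (_ ++ _)); apply: revstack_rec_fuel;
   rewrite ?leq_addr ?leq_addl.
Qed.

(* The one-line word of a permutation: the points 0, ..., n-1 of ['I_n] are
   relabelled 1, ..., n. *)
Definition perm_word (n : nat) (s : 'S_n) : seq nat :=
  [seq (s i).+1 | i <- enum 'I_n].

Definition des (w : seq nat) : nat :=
  count (fun j => nth 0 w j.+1 < nth 0 w j) (iota 0 (size w).-1).

Definition revstack_sortable (t n : nat) (s : 'S_n) : bool :=
  iter t revstack (perm_word s) == iota 1 n.

Definition v (t n i : nat) : nat :=
  #|[set s : 'S_n | revstack_sortable t s && (des (perm_word s) == i)]|.

(* Main.v *)
Require Import Defs.
From mathcomp Require Import all_boot perm.
From mathcomp Require Import zify.
Set Implicit Arguments.
Unset Strict Implicit.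
Unset Printing Implicit Defensive.

(** A word [L m R] with largest entry [m] is the in-order reading of a
    decreasing binary tree with root [m] and subtrees those of [L] and [R].
    In this picture a descent of the word is a node having a right child
    ([des_cat]), while revstack sort is a traversal right - left - root
    ([revstack_cat]).  When a node has only one child, the traversal cannot tell
    on which side that child hangs.  Hence moving every only child to the other
    side is an involution [flip] on words ([flipK]) that preserves the output of
    revstack sort ([revstack_flip]), and therefore preserves [t]-revstack
    sortability as soon as [t >= 1].

    A tree with [n] nodes has [n - 1] edges.  A node with two children carries
    one left and one right edge, before and after the flip; the edge of a node
    with one child is a right edge either before or after it.  So the numbers of
    descents before and after add up to [n - 1] ([des_flip]), and the involution
    exchanges the two sets of permutations to be compared. *)

Section Flip.

Implicit Types (L R w : seq nat) (k m : nat).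

(** The induction principle of decreasing binary trees, on in-order words. *)
Lemma decreasing_ind (P : seq nat -> Prop) :
  P [::] ->
  (forall L m R, uniq L -> uniq R -> all (fun x => x < m) (L ++ R) ->
     P L -> P R -> P (L ++ m :: R)) ->
  forall w, uniq w -> P w.
Proof.
move=> P0 PS w; have [k] := ubnP (size w); elim: k w => // k IHk [//|x s] hk.
have := bigmax_mem x s; have hle : all (fun y => y <= \max_(z <- x :: s) z) (x :: s).
  by apply/allP => y hy; apply: (@leq_bigmax_seq _ _ xpredT id).
move: (\max_(z <- x :: s) z) hle => m hle hm.
case/splitPr: hm hk hle => L R; rewrite size_cat /= ltnS => hk.
rewrite all_cat /= => /and3P[hL _ hR] hu; move: (hu).
rewrite cat_uniq /= => /and4P[uL _ mR uR].
have mL : m \notin L by apply/negP => mL; move: hu; rewrite cat_uniq /= mL andbF.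
have lt s' : all (fun y => y <= m) s' -> m \notin s' -> all (fun y => y < m) s'.
  move=> /allP hs' ms'; apply/allP => y hy; rewrite ltn_neqAle hs' // andbT.
  by apply: contraNneq ms' => <-.
apply: PS => //; first by rewrite all_cat !lt.
- by apply: IHk => //; lia.
- by apply: IHk => //; lia.
Qed.

(** One step of the flip, at the root [m].  Exchanging the two subtrees when one
    of them is empty moves an only child to the other side, and also covers the
    harmless case of a leaf. *)
Definition flip_node L m R : seq nat :=
  if (L == [::]) || (R == [::]) then R ++ m :: L else L ++ m :: R.

(** The argument [k] is fuel; any [k >= size w] gives the same result
    ([flip_rec_fuel]). *)
Fixpoint flip_rec k w : seq nat :=
  match k, w with
  | k'.+1, _ :: _ =>
      let m := \max_(x <- w) x in
      flip_node (flip_rec k' (take (index m w) w)) m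
                (flip_rec k' (drop (index m w).+1 w))
  | _, _ => [::]
  end.

Definition flip w : seq nat := flip_rec (size w) w.

Lemma flip_rec_cat k L m R : all (fun x => x < m) (L ++ R) ->
  flip_rec k.+1 (L ++ m :: R) = flip_node (flip_rec k L) m (flip_rec k R).
Proof.
rewrite all_cat => /andP[/allP hL /allP hR].
have hm : \max_(x <- L ++ m :: R) x = m.
  apply/eqP; rewrite eqn_leq; apply/andP; split.
    apply/bigmax_leqP_seq => x; rewrite mem_cat in_cons => hx _.
    by case/or3P: hx => [/hL/ltnW //|/eqP -> //|/hR/ltnW].
  by apply: (@leq_bigmax_seq _ _ xpredT id); rewrite // mem_cat mem_head orbT.
have hi : index m (L ++ m :: R) = size L.
  rewrite index_cat ifF /= ?eqxx ?addn0 //.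
  by apply/negP => /hL; rewrite ltnn.
have -> w : w = L ++ m :: R -> flip_rec k.+1 w =
    flip_node (flip_rec k (take (index (\max_(x <- w) x) w) w))
      (\max_(x <- w) x) (flip_rec k (drop (index (\max_(x <- w) x) w).+1 w)).
  - by case: w => //; case: (L).
  - by rewrite hm hi take_size_cat // -cat_rcons drop_size_cat ?size_rcons.
  by [].
Qed.

Lemma flip_rec_fuel w : uniq w -> forall k, size w <= k ->
  flip_rec k w = flip w.
Proof.
elim/decreasing_ind: w / => [[]//|L m R _ _ hm IHL IHR [|k]].
  by rewrite size_cat /= addnS.
rewrite /flip size_cat [size (m :: R)]/= addnS ltnS => hk.
by rewrite !flip_rec_cat ?(IHL k, IHR k, IHL (_ + _), IHR (_ + _)) //; lia.
Qed.

Lemma flip_cat L m R : uniq L -> uniq R -> all (fun x => x < m) (L ++ R) ->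
  flip (L ++ m :: R) = flip_node (flip L) m (flip R).
Proof.
move=> uL uR hm; rewrite {1}/flip size_cat /= addnS flip_rec_cat //.
by rewrite !flip_rec_fuel ?leq_addl ?leq_addr.
Qed.

Lemma perm_flip_node L m R : perm_eq (flip_node L m R) (L ++ m :: R).
Proof.
rewrite /flip_node; case: ifP => // _.
by rewrite -cat_rcons perm_catC perm_cat2l perm_rcons.
Qed.

Lemma perm_flip w : uniq w -> perm_eq (flip w) w.
Proof.
elim/decreasing_ind: w / => // L m R uL uR hm IHL IHR.
rewrite flip_cat // (perm_trans (perm_flip_node _ _ _)) //.
by rewrite perm_cat // perm_cons.
Qed.

Lemma flip_lt L m R : uniq L -> uniq R -> all (fun x => x < m) (L ++ R) ->
  all (fun x => x < m) (flip L ++ flip R).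
Proof.
move=> uL uR.
by rewrite !all_cat (perm_all _ (perm_flip uL)) (perm_all _ (perm_flip uR)).
Qed.

(** Flipping the subtrees keeps them empty or nonempty, so the second flip takes
    the same branch of [flip_node] at every node as the first one. *)
Lemma flipK w : uniq w -> flip (flip w) = w.
Proof.
elim/decreasing_ind: w / => // L m R uL uR hm IHL IHR.
have uL' : uniq (flip L) by rewrite (perm_uniq (perm_flip uL)).
have uR' : uniq (flip R) by rewrite (perm_uniq (perm_flip uR)).
have hm' := flip_lt uL uR hm.
have flip_nil s : uniq s -> (flip s == [::]) = (s == [::]).
  by move=> us; rewrite -!size_eq0 (perm_size (perm_flip us)).
rewrite flip_cat // /flip_node !flip_nil //; case: ifP => h; last first.
  by rewrite flip_cat // IHL IHR /flip_node h.
rewrite flip_cat // ?IHL ?IHR; last by rewrite all_cat andbC -all_cat.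
by rewrite /flip_node orbC h.
Qed.

(** The traversal of a node with an only child yields that child's traversal
    followed by the root, whichever the side of the child. *)
Lemma revstack_flip w : uniq w -> revstack (flip w) = revstack w.
Proof.
elim/decreasing_ind: w / => // L m R uL uR hm IHL IHR.
have hm' := flip_lt uL uR hm.
rewrite flip_cat // revstack_cat // -IHL -IHR /flip_node.
case: ifP => [h|_]; last by rewrite revstack_cat.
rewrite revstack_cat; last by rewrite all_cat andbC -all_cat.
by case/orP: h => /eqP ->; rewrite ?cats0.
Qed.

Lemma des_cons x y s : des (x :: y :: s) = (y < x) + des (y :: s).
Proof.
rewrite /des /= -[1]/(1 + 0) iotaDl count_map; congr (_ + _).
Qed.

(** The entry before [m] is smaller than [m], and so is the one after it: the only
    descent that [L] and [R] do not account for is at [m], and it is there exactly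
    when [m] has a right subtree. *)
Lemma des_cat L m R : all (fun x => x < m) (L ++ R) ->
  des (L ++ m :: R) = des L + des R + (R != [::]).
Proof.
elim: L => [|x [|y L] IHL] /=.
- by case: R => // y R /= /andP[ym _]; rewrite des_cons ym addnC.
- move=> /andP[xm hR]; rewrite des_cons ltnNge ltnW //=.
  by rewrite -[m :: R]cat0s IHL.
- move=> /andP[_ h]; rewrite !des_cons -addnA -addnA; congr (_ + _).
  by rewrite addnA -IHL.
Qed.

(** Descents are right edges of the tree, before the flip and after it, and
    [(size w).-1] is the total number of edges: an only edge is a right edge in
    exactly one of the two trees, and a pair of edges below a node contributes
    one right edge to each. *)
Lemma des_flip w : uniq w -> des (flip w) + des w = (size w).-1.
Proof.
elim/decreasing_ind: w / => // L m R uL uR hm IHL IHR.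
have hm' := flip_lt uL uR hm.
have hm'' : all (fun x => x < m) (flip R ++ flip L).
  by rewrite all_cat andbC -all_cat.
have sL := perm_size (perm_flip uL); have sR := perm_size (perm_flip uR).
rewrite flip_cat // des_cat // size_cat /= addnS /= /flip_node -!size_eq0 sL sR.
by case: ifP; rewrite des_cat // -!size_eq0 ?sL ?sR;
   move: (size L) (size R) IHL IHR => [|a] [|b] /=; lia.
Qed.

End Flip.

Lemma perm_word_inj n : injective (@perm_word n).
Proof.
move=> s s' /eq_in_map h; apply/permP => i; apply/val_inj/succn_inj.
by apply: h; rewrite mem_enum.
Qed.

Lemma perm_word_iota n (s : 'S_n) : perm_eq (perm_word s) (iota 1 n).
Proof.
apply: uniq_perm; rewrite ?iota_uniq //.
  by rewrite map_inj_uniq ?enum_uniq // => i j [] /val_inj /perm_inj.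
move=> x; rewrite mem_iota; apply/mapP/idP => [[i _ ->]|]; first exact: ltn_ord.
case: x => // x; rewrite add1n /= ltnS => hx.
by exists ((s^-1)%g (Ordinal hx)); rewrite ?mem_enum ?permKV.
Qed.

Lemma perm_word_onto n w : perm_eq w (iota 1 n) ->
  exists s : 'S_n, perm_word s == w.
Proof.
have -> : iota 1 n = iota_tuple n 1 by [].
case/tuple_permP => s ->; exists s; apply/eqP/eq_map => i.
by rewrite (tnth_nth 0) nth_iota.
Qed.

Lemma flip_perm_subproof n (s : 'S_n) :
  exists s' : 'S_n, perm_word s' == flip (perm_word s).
Proof.
have hs := perm_word_iota s; apply/perm_word_onto/(perm_trans _ hs).
by apply: perm_flip; rewrite (perm_uniq hs) iota_uniq.
Qed.

Definition flip_perm n (s : 'S_n) : 'S_n := xchoose (flip_perm_subproof s).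

Lemma perm_word_flip n (s : 'S_n) : perm_word (flip_perm s) = flip (perm_word s).
Proof. exact/eqP/(xchooseP (flip_perm_subproof s)). Qed.

Theorem theorem5p1 (t n i : nat) (ht : 1 <= t) (hn : 1 <= n) (hi : i <= n - 1) :
  v t n i = v t n (n - 1 - i).
Proof.
have uw (s : 'S_n) : uniq (perm_word s).
  by rewrite (perm_uniq (perm_word_iota s)) iota_uniq.
have flip_permK : involutive (@flip_perm n).
  by move=> s; apply: perm_word_inj; rewrite !perm_word_flip flipK.
rewrite /v -[RHS](card_preimset _ (inv_inj flip_permK)).
congr #|pred_of_set _|; apply/setP => s; rewrite !inE /revstack_sortable.
(* The first of the [t >= 1] passes already forgets the flip. *)
rewrite perm_word_flip -(prednK ht) !iterSr revstack_flip //; congr (_ && _).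
have := des_flip (uw s); rewrite (perm_size (perm_word_iota s)) size_iota.
lia.
Qed.
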